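(* Two unparameterized fanning curves of $n$-dimensional subspaces of $\mathbb{R}^{2n}$ are congruent if and only if, up to a projective change of parameters, the Schwarzians of any two of their special normal frames are conjugate by a constant $n\times n$ invertible matrix. Explicitly: let $\mathcal{A}(t)$, $t\in I$, and $\mathcal{B}(s)$, $s\in J$ ($I,J\subset\mathbb{R}$ open intervals), be special normal frames spanning parameterizations of two unparameterized fanning curves. Then the two unparameterized curves are congruent if and only if there exist a projective transformation $\sigma(t)=\frac{at+b}{ct+d}$ ($ad-bc\neq0$), restricting to a diffeomorphism from $I$ onto $J$, and a constant invertible $n\times n$ matrix $X$ such that for all $t\in I$ $$\{\mathcal{B}(\sigma(t)),t\}=X^{-1}\{\mathcal{A}(t),t\}X ,$$ where the left-hand side is the Schwarzian of the frame $t\mapsto\mathcal{B}(\sigma(t))$.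
   Context: A fanning frame is a smooth curve $\mathcal{A}(t)$, defined on an open interval, of real $2n\times n$ matrices such that the $2n\times 2n$ matrix $(\mathcal{A}(t)|\dot{\mathcal{A}}(t))$ obtained by juxtaposition is invertible for all $t$. A fanning curve is a smooth curve $\ell(t)$ of $n$-dimensional subspaces of $\mathbb{R}^{2n}$ that is the column span of a fanning frame. An unparameterized fanning curve is an equivalence class of fanning curves under reparameterization by diffeomorphisms between open intervals. Two unparameterized fanning curves, with parameterizations $\ell:I\to \mathrm{G}_n$ and $\tilde\ell:J\to \mathrm{G}_n$ (where $\mathrm{G}_n$ is the Grassmannian of $n$-dimensional subspaces of $\mathbb{R}^{2n}$), are congruent if there are an invertible linear transformation $\mathbf{T}$ of $\mathbb{R}^{2n}$ and a diffeomorphism $\sigma:I\to J$ with $\tilde\ell(\sigma(t))=\mathbf{T}\ell(t)$ for all $t\in I$. For a fanning frame there are unique smooth curves of $n\times n$ matrices $P(t),Q(t)$ with $\ddot{\mathcal{A}}+\dot{\mathcal{A}}P(t)+\mathcal{A}Q(t)=O$; the Schwarzian of $\mathcal{A}(t)$ is $\{\mathcal{A}(t),t\}=2Q(t)-\tfrac12P(t)^2-\dot P(t)$. A fanning frame $\mathcal{A}(t)$ is normal if for all $t$ the columns of $\ddot{\mathcal{A}}(t)$ are linear combinations of those of $\mathcal{A}(t)$. A special normal frame is a normal frame whose Schwarzian has identically zero trace. *)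

(* Defs.v *)
From mathcomp Require Import all_boot all_order all_algebra.
From mathcomp Require Import all_classical all_reals all_analysis.
Set Implicit Arguments.
Unset Strict Implicit.
Unset Printing Implicit Defensive.
Import Order.TTheory GRing.Theory Num.Theory.
Import numFieldNormedType.Exports.
Local Open Scope classical_set_scope.
Local Open Scope ring_scope.

(* Curves on an open interval I are total functions on R; only their values
   on I matter (derivatives at a point of an open set depend only on the germ
   of the function at that point). In ring_scope f^`() is the derivative of
   a polynomial, hence the %classic delimiters. *)

Section Smooth.
Variable R : realType.

Definition open_interval (I : set R) : Prop :=
  [/\ open I, is_interval I & I !=set0].

Definition smooth_on (V : normedModType R) (I : set R) (f : R -> V) : Prop :=
  forall (k : nat) (t : R), I t -> derivable (f^`(k))%classic t 1.

Definition diffeo (I J : set R) (f : R -> R) : Prop :=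
  [/\ smooth_on I f, set_bij I J f &
      exists2 g : R -> R, smooth_on J g & forall t, I t -> g (f t) = t].

Definition moebius (a b c d : R) : R -> R :=
  fun t => (a * t + b) / (c * t + d).

(* The condition c t + d != 0 keeps the pole out of I; it is needed because
   division by zero is total. *)
Definition projective_change (I J : set R) (s : R -> R) : Prop :=
  exists a b c d : R,
    [/\ s = moebius a b c d, a * d - b * c != 0 &
        forall t, I t -> c * t + d != 0] /\ diffeo I J s.

End Smooth.

Section FanningFrames.
Variables (R : realType) (n : nat).
Implicit Types (A B : R -> 'M[R]_(n + n, n)) (I J : set R) (t : R).

Definition juxt A (t : R) : 'M[R]_(n + n) := row_mx (A t) ((A^`())%classic t).

Definition fanning_frame I A : Prop :=
  [/\ open_interval I, smooth_on I A & forall t, I t -> juxt A t \in unitmx].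

(* The solution of A'' + A' P + A Q = 0, i.e., (A | A') (Q ; P) = - A''; see
   frame_eq and frame_eq_unique. *)
Definition frameQP A (t : R) : 'M[R]_(n + n, n) :=
  - (invmx (juxt A t) *m (A^`(2))%classic t).
Definition frameQ A (t : R) : 'M[R]_n := usubmx (frameQP A t).
Definition frameP A (t : R) : 'M[R]_n := dsubmx (frameQP A t).

Lemma frame_eq I A t : fanning_frame I A -> I t ->
  (A^`(2))%classic t + (A^`())%classic t *m frameP A t + A t *m frameQ A t = 0.
Proof.
move=> [_ _ inv] It; rewrite -addrA [X in _ + X]addrC -mul_row_col vsubmxK.
by rewrite /frameQP mulmxN mulKVmx ?subrr //; exact: inv.
Qed.

Lemma frame_eq_unique I A t (P Q : 'M[R]_n) : fanning_frame I A -> I t ->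
  (A^`(2))%classic t + (A^`())%classic t *m P + A t *m Q = 0 ->
  P = frameP A t /\ Q = frameQ A t.
Proof.
move=> [_ _ inv] It; rewrite -addrA [X in _ + X]addrC -mul_row_col => e.
have {}e : col_mx Q P = frameQP A t.
  rewrite /frameQP -mulmxN; move/eqP: e; rewrite addr_eq0 => /eqP ->.
  by rewrite opprK mulKmx //; exact: inv.
by rewrite /frameP /frameQ -e col_mxKu col_mxKd.
Qed.

Definition schwarzian A (t : R) : 'M[R]_n :=
  2 *: frameQ A t - 2^-1 *: (frameP A t *m frameP A t)
    - ((frameP A)^`())%classic t.

Definition colspan (M : 'M[R]_(n + n, n)) : {vspace 'cV[R]_(n + n)} :=
  <<[seq col j M | j : 'I_n]>>%VS.

Definition normal_frame I A : Prop :=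
  fanning_frame I A /\
  forall t, I t -> (colspan ((A^`(2))%classic t) <= colspan (A t))%VS.

Definition special_normal_frame I A : Prop :=
  normal_frame I A /\ forall t, I t -> \tr (schwarzian A t) = 0.

End FanningFrames.

Section FanningCurves.
Variables (R : realType) (n : nat).

Record pcurve := Pcurve {
  pdom : set R;
  pmap : R -> {vspace 'cV[R]_(n + n)} }.

Definition fanning_curve (l : pcurve) : Prop :=
  exists2 A : R -> 'M[R]_(n + n, n), fanning_frame (pdom l) A &
    forall t, pdom l t -> pmap l t = colspan (A t).

Definition reparam (l m : pcurve) : Prop :=
  exists2 s : R -> R, diffeo (pdom l) (pdom m) s &
    forall t, pdom l t -> pmap m (s t) = pmap l t.

(* This identifies curves on the same domain I that agree on I (take s to be
   the identity), so values outside the domain do not matter. *)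
Definition unparam_fanning_curve (C : set pcurve) : Prop :=
  exists2 l : pcurve, fanning_curve l &
    C = [set m | fanning_curve m /\ reparam l m].

Definition congruent (C D : set pcurve) : Prop :=
  exists l m : pcurve, [/\ C l, D m &
    exists (T : 'M[R]_(n + n)) (s : R -> R),
      [/\ T \in unitmx, diffeo (pdom l) (pdom m) s &
          forall t, pdom l t ->
            pmap m (s t) = (linfun (mulmx T) @: pmap l t)%VS]].

End FanningCurves.

(* Main.v *)
(* For a normal frame A'' = - A Q and {A} = 2 Q, while for f : I -> J with
   g = f''/f' the frame B o f has P = - g and Schwarzian
   f'^2 {B}(f) + (g' - g^2/2) Id.

   If B o f = T A X spans the image of A under T, comparing the coefficients of
   A' and A in the equation of B o f gives 2 X' = g X and
   (g' - g^2/2) X = {A} X - f'^2 X {B}(f). Multiplying by X^-1 and taking traces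
   yields g' = g^2/2, that is, f is projective, so that X conjugates the two
   Schwarzians; and since g = - 2 c / (c t + d), the matrix (c t + d) X(t) is
   constant.

   Conversely, if s = (a t + b)/(c t + d) and X conjugates the Schwarzians, the
   frame (c t + d) B(s(t)) X^-1 satisfies the same second order equation as A,
   hence equals T A for a constant T. *)
Require Import Defs.
From mathcomp Require Import all_boot all_order all_algebra.
From mathcomp Require Import all_classical all_reals all_analysis.
From mathcomp Require Import ring.
Import Order.TTheory GRing.Theory Num.Theory.
Import numFieldNormedType.Exports.
Local Open Scope classical_set_scope.
Local Open Scope ring_scope.

Set Implicit Arguments.
Unset Strict Implicit.
Unset Printing Implicit Defensive.

(** * Differentiability of finite order on an open set, and its closure properties *)

Definition ck_on (R : realType) (V : normedModType R) (k : nat) (I : set R)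
    (f : R -> V) : Prop :=
  forall (j : nat) (t : R), (j < k)%N -> I t -> derivable (f^`(j))%classic t 1.

Section Ck.
Variables (R : realType) (I : set R).
Hypothesis oI : open I.

(** Smoothness is handled through [ck_on] at every finite order, since closure under products,
    inverses and composition goes by induction on the order. [ck_on k] asks for [k] successive
    derivatives without continuity of the last one and is void at [k = 0], which makes the base
    cases trivial. *)
Lemma smooth_ckP (V : normedModType R) (f : R -> V) :
  smooth_on I f <-> forall k, ck_on k I f.
Proof.
split=> [sf k j t _|sf k t It]; first exact: sf.
exact: (sf k.+1 k t).
Qed.

Lemma near_eq_on (V : Type) (f g : R -> V) t :
  (forall x, I x -> f x = g x) -> I t -> \forall x \near t, f x = g x.
Proof.
move=> fg It; have : nbhs t I by exact: open_nbhs_nbhs.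
exact: filterS.
Qed.

Lemma eq_on_is_derive (V : normedModType R) (f g : R -> V) (t : R) d :
  (forall x, I x -> f x = g x) -> I t ->
  is_derive t 1 f d -> is_derive t 1 g d.
Proof. by move=> fg It; apply: near_eq_is_derive; exact: near_eq_on. Qed.

Lemma eq_on_derive1 (V : normedModType R) (f g : R -> V) t :
  (forall x, I x -> f x = g x) -> I t ->
  (f^`() t = g^`() t)%classic.
Proof.
by move=> fg It; rewrite !derive1E; apply: near_eq_derive; exact: near_eq_on.
Qed.

Lemma eq_on_derive1n (V : normedModType R) (f g : R -> V) :
  (forall x, I x -> f x = g x) ->
  forall k t, I t -> (f^`(k) t = g^`(k) t)%classic.
Proof.
move=> fg; elim=> [|k IHk] t It; first exact: fg.
by rewrite !derive1nS; exact: eq_on_derive1.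
Qed.

Lemma eq_on_ck (V : normedModType R) k (f g : R -> V) :
  (forall x, I x -> f x = g x) -> ck_on k I f -> ck_on k I g.
Proof.
move=> fg cf j t jk It; apply: (near_eq_derivable (f := (f^`(j))%classic)).
  by apply: near_eq_on It => x Ix; exact: eq_on_derive1n.
exact: cf.
Qed.

Lemma derive1_is_derive (V : normedModType R) (f : R -> V) (t : R) d :
  is_derive t 1 f d -> (f^`() t)%classic = d.
Proof. by rewrite derive1E => -[]. Qed.

Lemma derivable_is_derive (V : normedModType R) (f : R -> V) (t : R) :
  derivable f t 1 -> is_derive t 1 f (f^`() t)%classic.
Proof. by rewrite derive1E; exact: derivableP. Qed.

(** The successor step of the closure inductions: a formula [g] for the derivative on [I] is enough,
    because on an open set the higher derivatives of [f] are then those of [g]. *)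
Lemma ck_onS (V : normedModType R) k (f g : R -> V) :
  (forall t, I t -> is_derive t 1 f (g t)) -> ck_on k I g -> ck_on k.+1 I f.
Proof.
move=> df cg [|j] t jk It; first by have [] := df _ It.
rewrite derive1Sn.
apply: (@eq_on_ck _ k g (f^`())%classic) => // x Ix.
by rewrite (derive1_is_derive (df _ Ix)).
Qed.

Lemma ck_on_is_derive (V : normedModType R) k (f : R -> V) t :
  ck_on k.+1 I f -> I t -> is_derive t 1 f (f^`() t)%classic.
Proof. by move=> cf It; apply/derivable_is_derive/(cf 0%N). Qed.

Lemma ck_on_derive (V : normedModType R) k (f : R -> V) :
  ck_on k.+1 I f -> ck_on k I (f^`())%classic.
Proof. by move=> cf j t jk It; rewrite -derive1Sn; exact: cf. Qed.

Lemma ck_onW (V : normedModType R) k (f : R -> V) :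
  ck_on k.+1 I f -> ck_on k I f.
Proof. by move=> cf j t jk It; apply: cf => //; exact: ltnW. Qed.

Lemma ck_on0 (V : normedModType R) (f : R -> V) : ck_on 0 I f.
Proof. by []. Qed.

Lemma ck_cst (V : normedModType R) k (a : V) : ck_on k I (fun=> a).
Proof.
elim: k a => [|k IHk] a; first exact: ck_on0.
by apply: (@ck_onS _ k _ (fun=> 0)) => // t _; exact: is_derive_cst.
Qed.

Lemma ckD (V : normedModType R) k (f g : R -> V) :
  ck_on k I f -> ck_on k I g -> ck_on k I (fun t => f t + g t).
Proof.
elim: k f g => [|k IHk] f g cf cg; first exact: ck_on0.
apply: ck_onS; last exact: IHk (ck_on_derive cf) (ck_on_derive cg).
move=> t It; have df := ck_on_is_derive cf It; have dg := ck_on_is_derive cg It.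
exact: is_deriveD.
Qed.

Lemma ckM k (f g : R -> R) :
  ck_on k I f -> ck_on k I g -> ck_on k I (fun t => f t * g t).
Proof.
elim: k f g => [|k IHk] f g cf cg; first exact: ck_on0.
apply: (@ck_onS _ k _ (fun t => f t * (g^`() t)%classic + g t * (f^`() t)%classic)).
  move=> t It; have df := ck_on_is_derive cf It.
  by have dg := ck_on_is_derive cg It; exact: is_deriveM.
by apply: ckD; [exact: IHk (ck_onW cf) (ck_on_derive cg)
               |exact: IHk (ck_onW cg) (ck_on_derive cf)].
Qed.

Lemma ck_sum (T : Type) (r : seq T) (P : pred T) (F : T -> R -> R) k :
  (forall i, ck_on k I (F i)) ->
  ck_on k I (fun t => \sum_(i <- r | P i) F i t).
Proof.
move=> cF; elim: r => [|i r IHr].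
  by under eq_fun do rewrite big_nil; exact: ck_cst.
under eq_fun do rewrite big_cons.
by case: (P i); [exact: (ckD (cF i) IHr)|exact: IHr].
Qed.

Lemma ck_prod (T : Type) (r : seq T) (P : pred T) (F : T -> R -> R) k :
  (forall i, ck_on k I (F i)) ->
  ck_on k I (fun t => \prod_(i <- r | P i) F i t).
Proof.
move=> cF; elim: r => [|i r IHr].
  by under eq_fun do rewrite big_nil; exact: ck_cst.
under eq_fun do rewrite big_cons.
by case: (P i); [exact: (ckM (cF i) IHr)|exact: IHr].
Qed.

(** The derivative [- f' / f^2] involves [1 / f] only to order [k], so the induction closes. *)
Lemma ckV k (f : R -> R) : (forall t, I t -> f t != 0) ->
  ck_on k I f -> ck_on k I (fun t => (f t)^-1).
Proof.
move=> f0; elim: k => [|k IHk] cf; first exact: ck_on0.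
apply: (@ck_onS _ k _ (fun t => -1 * ((f t)^-1 * (f t)^-1) * (f^`() t)%classic)).
  move=> t It; have df := ck_on_is_derive cf It.
  apply: is_derive_eq; first by apply: is_deriveV; exact: f0.
  by rewrite /GRing.scale /= mulN1r expr2 invfM.
have cV := IHk (ck_onW cf).
have c1 := ckM (@ck_cst R k (-1)) (ckM cV cV).
have c2 := ckM c1 (ck_on_derive cf).
exact: c2.
Qed.

Lemma ck_id k : ck_on k I (fun t : R => t).
Proof.
case: k => [|k]; first exact: ck_on0.
by apply: (@ck_onS _ k _ (fun _ : R => 1 : R)); exact: ck_cst.
Qed.

Lemma is_derive_mxP m n (M : R -> 'M[R]_(m, n)) (t : R) (D : 'M[R]_(m, n)) :
  is_derive t 1 M D <-> forall i j, is_derive t 1 (fun x => M x i j) (D i j).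
Proof.
split=> [[dM MD] i j|dM].
  split; first by move/derivable_mxP : dM; exact.
  by rewrite -MD derive_mx// mxE.
have dM' : derivable M t 1 by apply/derivable_mxP => i j; case: (dM i j).
split=> //; apply/matrixP => i j.
by rewrite derive_mx// mxE; case: (dM i j).
Qed.

Lemma ck_mxP m n k (M : R -> 'M[R]_(m, n)) :
  ck_on k I M <-> forall i j, ck_on k I (fun t => M t i j).
Proof.
elim: k M => [|k IHk] M; first by split=> _ *; exact: ck_on0.
split=> [cM i j|cM].
  apply: ck_onS; last exact: (IHk _).1 (ck_on_derive cM) i j.
  by move=> t It; apply: (is_derive_mxP _ _ _).1; exact: ck_on_is_derive cM It.
apply: (@ck_onS _ k _ (fun t => \matrix_(i, j) ((fun x => M x i j)^`() t)%classic)).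
  move=> t It; apply/is_derive_mxP => i j; rewrite mxE.
  exact: ck_on_is_derive (cM i j) It.
apply/IHk => i j; under eq_fun do rewrite mxE.
exact: ck_on_derive.
Qed.

Lemma ck_mulmx m n p k (M : R -> 'M[R]_(m, n)) (N : R -> 'M[R]_(n, p)) :
  ck_on k I M -> ck_on k I N -> ck_on k I (fun t => M t *m N t).
Proof.
move=> /ck_mxP cM /ck_mxP cN; apply/ck_mxP => i j.
under eq_fun do rewrite mxE.
by apply: ck_sum => l; exact: (ckM (cM _ _) (cN _ _)).
Qed.

Lemma ck_scale m n k (f : R -> R) (M : R -> 'M[R]_(m, n)) :
  ck_on k I f -> ck_on k I M -> ck_on k I (fun t => f t *: M t).
Proof.
move=> cf /ck_mxP cM; apply/ck_mxP => i j.
by under eq_fun do rewrite mxE; exact: (ckM cf (cM _ _)).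
Qed.

Lemma ck_det n k (M : R -> 'M[R]_n) :
  ck_on k I M -> ck_on k I (fun t => \det (M t)).
Proof.
move=> /ck_mxP cM; apply: ck_sum => s.
apply: (ckM (@ck_cst _ _ _)); apply: ck_prod => i; exact: cM.
Qed.

(** By Cramer's formula the inverse is the adjugate divided by the determinant, and both are
    polynomial in the entries. *)
Lemma ck_invmx n k (M : R -> 'M[R]_n) : (forall t, I t -> M t \in unitmx) ->
  ck_on k I M -> ck_on k I (fun t => invmx (M t)).
Proof.
move=> uM cM.
apply: (@eq_on_ck _ k (fun t => (\det (M t))^-1 *: \adj (M t))).
  by move=> x Ix; rewrite /invmx uM.
apply: ck_scale.
  apply: (ckV _ (ck_det cM)) => t It.
  by rewrite -unitfE -unitmxE uM.
move/ck_mxP : cM => cM.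
apply/ck_mxP => i j; under eq_fun do rewrite mxE.
apply: (ckM (@ck_cst _ _ _)).
apply: ck_det; apply/ck_mxP => a b; under eq_fun do rewrite !mxE.
exact: cM.
Qed.

End Ck.

(** * Derivatives of matrix curves, constancy criteria and diffeomorphisms of intervals *)

Section Calculus.
Variable R : realType.
Implicit Types (I J : set R).

Lemma is_derive_mulmx m n p (M : R -> 'M[R]_(m, n)) (N : R -> 'M[R]_(n, p))
    (t : R) dM dN :
  is_derive t 1 M dM -> is_derive t 1 N dN ->
  is_derive t 1 (fun x => M x *m N x) (M t *m dN + dM *m N t).
Proof.
move=> /is_derive_mxP hM /is_derive_mxP hN; apply/is_derive_mxP => i j.
under eq_fun do rewrite mxE.
rewrite !mxE -big_split /=.
rewrite (_ : (fun _ => _) = \sum_(l < n) (fun x => M x i l * N x l j)); last first.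
  by apply/funext => x; rewrite fct_sumE.
apply: is_derive_sum => l.
apply: (is_derive_eq (is_deriveM (hM i l) (hN l j))).
by rewrite /GRing.scale /= [N t l j * _]mulrC.
Qed.

Lemma is_derive_scalemx m n (f : R -> R) (M : R -> 'M[R]_(m, n)) (t : R) df dM :
  is_derive t 1 f df -> is_derive t 1 M dM ->
  is_derive t 1 (fun x => f x *: M x) (f t *: dM + df *: M t).
Proof.
move=> hf /is_derive_mxP hM; apply/is_derive_mxP => i j.
under eq_fun do rewrite mxE.
apply: (is_derive_eq (is_deriveM hf (hM i j))).
by rewrite !mxE /GRing.scale /= [M t i j * _]mulrC.
Qed.

Lemma is_derive_compmx m n (M : R -> 'M[R]_(m, n)) (f : R -> R) (t : R) df dM :
  is_derive (f t) 1 M dM -> is_derive t 1 f df ->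
  is_derive t 1 (fun x => M (f x)) (df *: dM).
Proof.
move=> /is_derive_mxP hM hf; apply/is_derive_mxP => i j.
have := is_derive1_comp (hM i j) hf.
by rewrite mxE mulrC.
Qed.

Lemma is_derive_row_mx m n p (M : R -> 'M[R]_(m, n)) (N : R -> 'M[R]_(m, p))
    (t : R) dM dN :
  is_derive t 1 M dM -> is_derive t 1 N dN ->
  is_derive t 1 (fun x => row_mx (M x) (N x)) (row_mx dM dN).
Proof.
move=> /is_derive_mxP hM /is_derive_mxP hN; apply/is_derive_mxP => i j.
by under eq_fun do rewrite mxE; rewrite mxE; case: splitP => l _.
Qed.

Lemma ck_row_mx I k m n p (M : R -> 'M[R]_(m, n)) (N : R -> 'M[R]_(m, p)) :
  open I -> ck_on k I M -> ck_on k I N ->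
  ck_on k I (fun x => row_mx (M x) (N x)).
Proof.
move=> oI /(ck_mxP oI) cM /(ck_mxP oI) cN; apply/(ck_mxP oI) => i j.
by under eq_fun do rewrite mxE; case: splitP => l _; [exact: cM|exact: cN].
Qed.

Lemma ck_usubmx I k m n p (M : R -> 'M[R]_(m + n, p)) :
  open I -> ck_on k I M -> ck_on k I (fun x => usubmx (M x)).
Proof.
move=> oI /(ck_mxP oI) cM; apply/(ck_mxP oI) => i j.
by under eq_fun do rewrite mxE; exact: cM.
Qed.

Lemma ck_comp I J k (h f : R -> R) : open I -> open J ->
  (forall t, I t -> J (f t)) ->
  ck_on k J h -> ck_on k I f -> ck_on k I (fun t => h (f t)).
Proof.
move=> oI oJ IJ; elim: k h => [|k IHk] h ch cf; first exact: ck_on0.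
have d t : I t ->
    is_derive t 1 (fun t => h (f t)) ((h^`() (f t))%classic * (f^`() t)%classic).
  move=> It; have dh := ck_on_is_derive ch (IJ t It).
  by have df := ck_on_is_derive cf It; exact: (is_derive1_comp dh df).
apply: (ck_onS oI d).
exact: (ckM oI (IHk _ (ck_on_derive ch) (ck_onW cf)) (ck_on_derive cf)).
Qed.

Lemma ck_compmx I J k m n (M : R -> 'M[R]_(m, n)) (f : R -> R) :
  open I -> open J -> (forall t, I t -> J (f t)) ->
  ck_on k J M -> ck_on k I f -> ck_on k I (fun t => M (f t)).
Proof.
move=> oI oJ IJ /(ck_mxP oJ) cM cf; apply/(ck_mxP oI) => i j.
exact: (ck_comp oI oJ IJ (cM i j) cf).
Qed.

Lemma smooth_is_derive (V : normedModType R) I (f : R -> V) k t :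
  smooth_on I f -> I t -> is_derive t 1 (f^`(k))%classic (f^`(k.+1) t)%classic.
Proof. by move=> sf It; rewrite derive1nS; exact/derivable_is_derive/sf. Qed.

Lemma derive0_const I (f : R -> R) : is_interval I ->
  (forall t, I t -> is_derive t 1 f 0) -> forall x y, I x -> I y -> f x = f y.
Proof.
move=> iI df.
have lt x y : x < y -> I x -> I y -> f x = f y.
  move=> xy Ix Iy.
  have xyI z : z \in `[x, y] -> I z.
    by rewrite in_itv/= => xzy; exact: (iI x y).
  have [z zxy| |z zxy] := @MVT R f (fun=> 0) x y xy.
  - by apply: df; apply: xyI; exact: subset_itv_oo_cc zxy.
  - apply: derivable_within_continuous => z zxy.
    by have [] := df z (xyI _ zxy).
  - by rewrite mul0r => /eqP; rewrite subr_eq0 => /eqP ->.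
move=> x y Ix Iy; case: (ltgtP x y) => [xy|yx|->] //; first exact: lt.
by apply/esym; exact: lt.
Qed.

Lemma derive0_constmx I m n (M : R -> 'M[R]_(m, n)) : is_interval I ->
  (forall t, I t -> is_derive t 1 M 0) -> forall x y, I x -> I y -> M x = M y.
Proof.
move=> iI dM x y Ix Iy; apply/matrixP => i j.
apply: (@derive0_const I (fun t => M t i j)) => // t It.
by have /is_derive_mxP/(_ i j) := dM t It; rewrite mxE.
Qed.

Lemma is_derive_unique (V : normedModType R) (f : R -> V) (t : R) d1 d2 :
  is_derive t 1 f d1 -> is_derive t 1 f d2 -> d1 = d2.
Proof. by move=> [_ <-] [_ <-]. Qed.

(** The chain rule applied to [g (f t) = t] gives a product of derivatives equal to 1. *)
Lemma diffeo_derive_neq0 I J (f : R -> R) t : open I ->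
  diffeo I J f -> I t -> (f^`() t)%classic != 0.
Proof.
move=> oI [sf [fIJ _ _] [g sg gK]] It.
have df : is_derive t 1 f (f^`() t)%classic by exact: (smooth_is_derive 0 sf It).
have dg := smooth_is_derive 0 sg (fIJ t It).
have d1 := is_derive1_comp dg df.
have d2 : is_derive t 1 (g \o f) 1.
  apply: (eq_on_is_derive oI (f := id) _ It) => x Ix.
  by rewrite /= gK.
have := is_derive_unique d2 d1.
by apply: contra_eq_neq => ->; rewrite mulr0 oner_neq0.
Qed.

(** The definition of [diffeo] only asks that [g] undo [f] on [I]; surjectivity of [f] onto [J]
    makes the inverse two-sided. *)
Lemma diffeo_sym I J (f : R -> R) : diffeo I J f ->
  exists2 g, diffeo J I g & forall t, I t -> g (f t) = t.
Proof.
move=> [sf [fIJ fi fs] [g sg gK]]; exists g => //.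
have gJ s : J s -> I (g s) /\ f (g s) = s.
  by move=> /fs [t It <-]; rewrite gK.
split=> //; last by exists f => // s /gJ [].
split.
- by move=> s /gJ [].
- move=> x y /set_mem/gJ [_ fx] /set_mem/gJ [_ fy] xy.
  by rewrite -fx -fy xy.
- by move=> t It; exists (f t); [exact: fIJ|exact: gK].
Qed.

Lemma diffeo_comp I J K (f g : R -> R) : open I -> open J -> open K ->
  diffeo I J f -> diffeo J K g -> diffeo I K (g \o f).
Proof.
move=> oI oJ oK df dg.
have [f' [sf' [f'J _ _] _] f'K] := diffeo_sym df.
have [g' [sg' [g'K' _ _] _] g'K] := diffeo_sym dg.
case: df dg => [sf bf _] [sg bg _].
have fJ : forall t, I t -> J (f t) by case: bf.
split.
- apply/smooth_ckP => k.
  exact: (ck_comp oI oJ fJ ((smooth_ckP _ _).1 sg k) ((smooth_ckP _ _).1 sf k)).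
- exact: set_bij_comp bf bg.
exists (f' \o g') => [|t It]; last by rewrite /= g'K ?f'K//; exact: fJ.
apply/smooth_ckP => k.
exact: (ck_comp oK oJ g'K' ((smooth_ckP _ _).1 sf' k) ((smooth_ckP _ _).1 sg' k)).
Qed.


End Calculus.

(** * Column spans and their behaviour under matrix multiplication *)

Section ColumnSpan.
Variables (R : realType) (n : nat).
Implicit Types M N : 'M[R]_(n + n, n).

Lemma mulmx_cv_sum M (x : 'cV[R]_n) : M *m x = \sum_i x i 0 *: col i M.
Proof.
apply/colP => k; rewrite mxE summxE; apply: eq_bigr => i _.
by rewrite !mxE mulrC.
Qed.

Lemma colspanP M (v : 'cV[R]_(n + n)) :
  reflect (exists x : 'cV[R]_n, v = M *m x) (v \in colspan M).
Proof.
rewrite /colspan span_def big_image /=; apply: (iffP memv_sumP).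
  move=> [w wM ->]; have {}wM i : exists a : R, w i = a *: col i M.
    by apply/vlineP; exact: wM.
  have [a wa] := choice wM; exists (\col_i a i).
  by rewrite mulmx_cv_sum; apply: eq_bigr => i _; rewrite mxE.
move=> [x ->]; exists (fun i => x i 0 *: col i M); last exact: mulmx_cv_sum.
by move=> i _; apply/vlineP; exists (x i 0).
Qed.

(** The columns of [X] are coordinate vectors chosen one by one for the columns of [M]. *)
Lemma colspan_subP M N :
  reflect (exists X : 'M[R]_n, M = N *m X) (colspan M <= colspan N)%VS.
Proof.
apply: (iffP idP) => [MN|[X ->]].
  have h i : exists x : 'cV[R]_n, col i M = N *m x.
    apply/colspanP/(subvP MN)/colspanP; exists (delta_mx i 0).
    by rewrite colE.
  have [x hx] := choice h.
  exists (\matrix_(i, j) x j i 0).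
  apply/matrixP => i j; have /matrixP/(_ i 0) := hx j.
  rewrite !mxE => ->; apply: eq_bigr => k _; by rewrite mxE.
apply/subvP => v /colspanP [x ->]; apply/colspanP; exists (X *m x).
by rewrite mulmxA.
Qed.

Lemma colspan_mulmxr M (X : 'M[R]_n) : X \in unitmx ->
  colspan (M *m X) = colspan M.
Proof.
move=> uX; apply/eqP; rewrite eqEsubv; apply/andP; split.
  by apply/colspan_subP; exists X.
by apply/colspan_subP; exists (invmx X); rewrite mulmxK.
Qed.

Lemma colspan_mulmxl M (T : 'M[R]_(n + n)) :
  (linfun (mulmx T) @: colspan M)%VS = colspan (T *m M).
Proof.
apply/vspaceP => v; apply/idP/colspanP => [/memv_imgP[w /colspanP[x ->] ->]|].
  by exists x; rewrite lfunE /= mulmxA.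
move=> [x ->]; apply/memv_imgP; exists (M *m x); last by rewrite lfunE /= mulmxA.
by apply/colspanP; exists x.
Qed.

End ColumnSpan.

(** * The second order equation of a frame, and its change under reparameterization *)

Section Frames.
Variables (R : realType) (n : nat).
Implicit Types (A B : R -> 'M[R]_(n + n, n)) (I J : set R) (t : R).

Lemma schwarzian_eq_on I A B t : open I -> (forall x, I x -> A x = B x) ->
  I t -> schwarzian A t = schwarzian B t.
Proof.
move=> oI AB It.
have QP x : I x -> frameQP A x = frameQP B x.
  move=> Ix; rewrite /frameQP /juxt (eq_on_derive1 oI AB Ix).
  by rewrite (eq_on_derive1n oI AB) // AB.
have P x : I x -> frameP A x = frameP B x by move=> Ix; rewrite /frameP QP.
have Q : frameQ A t = frameQ B t by rewrite /frameQ QP.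
exact: (f_equal3 (fun q p d => 2 *: q - 2^-1 *: (p *m p) - d)
  Q (P t It) (eq_on_derive1 oI P It)).
Qed.

(** Normality writes [A''] as [A X], so uniqueness of the coefficients gives [P = 0] and [Q = - X].
    As [P] vanishes on the whole open set [I], its derivative vanishes there too. *)
Lemma normal_frame_eqs I A t : normal_frame I A -> I t ->
  [/\ frameP A t = 0, schwarzian A t = 2 *: frameQ A t &
      (A^`(2) t)%classic = - (A t *m frameQ A t)].
Proof.
move=> [fA nA] It; have [[oI _ _] _ _] := fA.
have P0 x : I x -> frameP A x = 0.
  move=> Ix; have /colspan_subP[X AX] := nA x Ix.
  have [|<- //] := @frame_eq_unique _ _ I A x 0 (- X) fA Ix.
  by rewrite mulmx0 addr0 mulmxN AX subrr.
split; first exact: P0.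
  have dP0 : ((frameP A)^`() t)%classic = 0.
    by rewrite (eq_on_derive1 (g := fun=> 0) oI P0 It) derive1_cst.
  by rewrite /schwarzian P0// mulmx0 scaler0 subr0 dP0 subr0.
have := frame_eq fA It; rewrite P0// mulmx0 addr0.
by move/eqP; rewrite addr_eq0 => /eqP.
Qed.

(** The columns of [A] and [A'] together form a basis; this is what allows coefficients to be
    compared. *)
Lemma juxt_eq0 A t (P Q : 'M[R]_n) : juxt A t \in unitmx ->
  (A^`() t)%classic *m P + A t *m Q = 0 -> P = 0 /\ Q = 0.
Proof.
move=> uA; rewrite addrC -mul_row_col => e.
have /eqP : col_mx Q P = 0 by rewrite -(mulKmx uA (col_mx Q P)) e mulmx0.
by rewrite col_mx_eq0 => /andP[/eqP -> /eqP ->].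
Qed.

Lemma ck_juxt I A k : open I -> smooth_on I A -> ck_on k I (juxt A).
Proof.
move=> oI /smooth_ckP sA; apply: ck_row_mx => //.
exact: ck_on_derive.
Qed.

Lemma is_derive_comp_frame I J B (f : R -> R) t k : smooth_on J B ->
  smooth_on I f -> (forall t, I t -> J (f t)) -> I t ->
  is_derive t 1 (fun x => (B^`(k) (f x))%classic)
    ((f^`() t)%classic *: (B^`(k.+1) (f t))%classic).
Proof.
move=> sB sf IJ It.
have dB := smooth_is_derive k sB (IJ t It).
exact: (is_derive_compmx dB (smooth_is_derive 0 sf It)).
Qed.

(** The logarithmic derivative of [f']. With [g] for this function, [g' - g^2 / 2] is the classical
    Schwarzian derivative of [f]. *)
Definition log_derive1 (f : R -> R) (t : R) : R :=
  (f^`(2) t)%classic / (f^`() t)%classic.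

Lemma derivable_log_derive1 I J f t : open I -> diffeo I J f -> I t ->
  is_derive t 1 (log_derive1 f) ((log_derive1 f)^`() t)%classic.
Proof.
move=> oI df It; apply: derivable_is_derive.
have sf : smooth_on I f by case: df.
have f0 x : I x -> (f^`() x)%classic != 0 by exact: (diffeo_derive_neq0 oI df).
have c1 : ck_on 1 I (f^`())%classic.
  by apply: ck_on_derive; move/smooth_ckP: sf; exact.
have c2 : ck_on 1 I (f^`(2))%classic.
  by rewrite derive1nS; apply: ck_on_derive; apply: ck_on_derive; move/smooth_ckP: sf; exact.
exact: (ckM oI c2 (ckV oI f0 c1) (j := 0) _ It).
Qed.

(** With [F = B \o f] and [g = log_derive1 f], two applications of the chain rule and [B'' = - B Q]
    give [F'' = g F' - f'^2 F Q(f)]. Uniqueness of the coefficients reads off [P] and [Q], and the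
    scalar term in the Schwarzian comes from [- P^2 / 2 - P'] with [P = - g]. *)
Lemma normal_frame_comp I J B f : open_interval I -> diffeo I J f ->
    normal_frame J B ->
  fanning_frame I (B \o f) /\ forall t, I t ->
  [/\ frameP (B \o f) t = - (log_derive1 f t)%:M,
      frameQ (B \o f) t = (f^`() t)%classic ^+ 2 *: frameQ B (f t) &
      schwarzian (B \o f) t = 2 *: frameQ (B \o f) t +
        ((log_derive1 f)^`()%classic t - log_derive1 f t ^+ 2 / 2)%:M].
Proof.
move=> iI df nB; have [oI _ _] := iI; have [[oiJ sB uB] _] := nB.
have [oJ _ _] := oiJ.
have [sf [IJ _ _] _] := df.
have f0 x : I x -> (f^`() x)%classic != 0 by exact: (diffeo_derive_neq0 oI df).
have d1 t : I t -> is_derive t 1 (B \o f)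
    ((f^`() t)%classic *: (B^`() (f t))%classic).
  by move=> It; exact: (is_derive_comp_frame 0 sB sf IJ It).
have E1 t : I t ->
    ((B \o f)^`() t)%classic = (f^`() t)%classic *: (B^`() (f t))%classic.
  by move=> It; exact: (derive1_is_derive (d1 t It)).
have d2 t : I t -> is_derive t 1
    (fun t => (f^`() t)%classic *: (B^`() (f t))%classic)
    ((f^`() t)%classic *: ((f^`() t)%classic *: (B^`(2) (f t))%classic)
     + (f^`(2) t)%classic *: (B^`() (f t))%classic).
  move=> It; have dB := is_derive_comp_frame 1 sB sf IJ It.
  exact: (is_derive_scalemx (smooth_is_derive 1 sf It) dB).
have E2 t : I t -> ((B \o f)^`(2) t)%classic =
    (f^`() t)%classic *: ((f^`() t)%classic *: (B^`(2) (f t))%classic)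
     + (f^`(2) t)%classic *: (B^`() (f t))%classic.
  move=> It; rewrite derive1nS (eq_on_derive1 oI E1 It).
  exact: (derive1_is_derive (d2 t It)).
have fF : fanning_frame I (B \o f).
  split=> //.
    apply/smooth_ckP => k.
    exact: (ck_compmx oI oJ IJ ((smooth_ckP _ _).1 sB k) ((smooth_ckP _ _).1 sf k)).
  move=> t It.
  (* Reparameterization only rescales the second block of columns by [f'], which does not vanish. *)
  have -> : juxt (B \o f) t =
      juxt B (f t) *m block_mx 1%:M 0 0 ((f^`() t)%classic%:M).
    rewrite /juxt mul_row_block !mulmx0 addr0 add0r mulmx1 E1//.
    by rewrite mul_mx_scalar.
  rewrite unitmx_mul (uB _ (IJ t It)) andTb unitmxE det_ublock det1 mul1r det_scalar.
  by rewrite unitfE expf_neq0// f0.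
have PQ t : I t -> frameP (B \o f) t = - (log_derive1 f t)%:M /\
    frameQ (B \o f) t = (f^`() t)%classic ^+ 2 *: frameQ B (f t).
  move=> It; have [_ _ B2] := normal_frame_eqs nB (IJ t It).
  have [|-> ->] := @frame_eq_unique _ _ I (B \o f) t (- (log_derive1 f t)%:M)
    ((f^`() t)%classic ^+ 2 *: frameQ B (f t)) fF It; last by [].
  rewrite E1// E2// B2 mulmxN mul_mx_scalar !scalerA /log_derive1.
  by rewrite divfK ?f0// -expr2 -scalemxAr scalerN addrK addNr.
split=> // t It; have [Pt Qt] := PQ t It; split=> //.
have dP : (frameP (B \o f))^`()%classic t = - ((log_derive1 f)^`()%classic t)%:M.
  rewrite (eq_on_derive1 oI (fun x Ix => (PQ x Ix).1) It).
  apply: derive1_is_derive; apply/is_derive_mxP => i j.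
  under eq_fun do rewrite !mxE.
  rewrite !mxE; have dg := derivable_log_derive1 oI df It.
  case: (i == j); first exact: is_deriveN dg.
  by rewrite [X in is_derive _ _ _ X]oppr0; exact: (is_derive_cst (- 0 : R) t 1).
rewrite /schwarzian dP Pt mulNmx mulmxN opprK opprK -scalar_mxM.
rewrite scale_scalar_mx [log_derive1 f t ^+ 2 / 2]mulrC -expr2 raddfB /=.
by rewrite -addrA [- _ + _]addrC.
Qed.
End Frames.

(** * Projective maps as the solutions of the Riccati equation [g' = g^2 / 2] *)

Section Moebius.
Variable R : realType.
Implicit Types (I J : set R) (f : R -> R).

Lemma is_derive_affine (a b : R) (t : R) :
  is_derive t 1 (fun x => a * x + b) a.
Proof.
have h := is_deriveD (is_deriveZ a (is_derive_id t 1)) (is_derive_cst b t 1).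
by apply: (is_derive_eq h); rewrite addr0 /GRing.scale /= mulr1.
Qed.

Lemma is_derive_div f g (t df dg : R) : g t != 0 ->
  is_derive t 1 f df -> is_derive t 1 g dg ->
  is_derive t 1 (fun x => f x / g x) ((df * g t - f t * dg) / g t ^+ 2).
Proof.
move=> g0 hf hg; apply: (is_derive_eq (is_deriveM hf (is_deriveV g0 hg))).
by rewrite /GRing.scale /=; field.
Qed.

Lemma is_derive_moebius (a b c d t : R) : c * t + d != 0 ->
  is_derive t 1 (moebius a b c d) ((a * d - b * c) / (c * t + d) ^+ 2).
Proof.
move=> v0; have h := is_derive_div (t := t) (f := fun x => a * x + b)
  (g := fun x => c * x + d) v0 (is_derive_affine a b t) (is_derive_affine c d t).
apply: (is_derive_eq h).
by congr (_ / _); ring.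
Qed.

Lemma moebius_log_derive1 I (a b c d : R) : open I -> a * d - b * c != 0 ->
  (forall t, I t -> c * t + d != 0) -> forall t, I t ->
  log_derive1 (moebius a b c d) t = - 2 * c / (c * t + d).
Proof.
move=> oI det0 v0 t It; have v0t := v0 t It.
have E1 x : I x -> ((moebius a b c d)^`() x)%classic =
    (a * d - b * c) / (c * x + d) ^+ 2.
  by move=> Ix; exact: (derive1_is_derive (is_derive_moebius a b (v0 x Ix))).
rewrite /log_derive1 derive1nS (eq_on_derive1 oI E1 It) E1//.
have dv := is_derive_affine c d t.
have v20 : (fun x => (c * x + d) ^+ 2) t != 0 by rewrite /= expf_neq0.
have h := is_derive_div (t := t) (f := fun=> a * d - b * c)
  (g := fun x => (c * x + d) ^+ 2) v20
  (is_derive_cst _ t 1) (is_deriveX 2 dv).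
rewrite (derive1_is_derive h) /GRing.scale /= expr1.
by field; rewrite det0 v0t.
Qed.

(** This is the vanishing of the Schwarzian derivative of a projective map; both sides equal
    [2 c^2 / (c t + d)^2]. *)
Lemma moebius_riccati I (a b c d : R) : open I -> a * d - b * c != 0 ->
  (forall t, I t -> c * t + d != 0) -> forall t, I t ->
  ((log_derive1 (moebius a b c d))^`() t)%classic =
    log_derive1 (moebius a b c d) t ^+ 2 / 2.
Proof.
move=> oI det0 v0 t It.
have E := moebius_log_derive1 oI det0 v0.
have v0t : (fun x => c * x + d) t != 0 := v0 t It.
rewrite (eq_on_derive1 oI E It) E//.
have h := is_derive_div (t := t) (f := fun=> - 2 * c) (g := fun x => c * x + d) v0t
  (is_derive_cst _ t 1) (is_derive_affine c d t).
rewrite (derive1_is_derive h) /=.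
by field; exact: v0t.
Qed.

(* With v(t) = 1 - g(t0) (t - t0)/2, where g = f''/f', the following are
   constant on I: (g v - g(t0))^2 / f', then f' v^2, and finally
   f - f'(t0) (t - t0) / v. *)
Lemma riccati_moebius I J f : open_interval I -> diffeo I J f ->
  (forall t, I t ->
    ((log_derive1 f)^`() t)%classic = log_derive1 f t ^+ 2 / 2) ->
  exists a b c d : R, [/\ a * d - b * c != 0,
    forall t, I t -> c * t + d != 0 &
    forall t, I t -> f t = moebius a b c d t].
Proof.
move=> [oI iI [t0 It0]] df ric.
have sf : smooth_on I f by case: df.
have f0 x : I x -> (f^`() x)%classic != 0 by exact: (diffeo_derive_neq0 oI df).
set f1 : R -> R := (f^`())%classic in f0.
set f2 : R -> R := (f^`(2))%classic.
set g := log_derive1 f.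
have fg x : I x -> f2 x = g x * f1 x.
  by move=> Ix; rewrite /g /log_derive1 divfK ?f0.
have d0 x : I x -> is_derive x 1 f (f1 x) := smooth_is_derive 0 sf.
have d1 x : I x -> is_derive x 1 f1 (f2 x) := smooth_is_derive 1 sf.
have dg x : I x -> is_derive x 1 g (g x ^+ 2 / 2).
  move=> Ix; rewrite -ric//; exact: (derivable_log_derive1 oI df Ix).
(* The substitution [g = - 2 v' / v] turns the Riccati equation into [v'' = 0], hence an affine [v];
   it is normalized by [v t0 = 1], which forces [v' = - g t0 / 2]. *)
pose c : R := - g t0 / 2; pose d : R := 1 + g t0 * t0 / 2.
pose v (x : R) : R := c * x + d.
have dv (x : R) : is_derive x 1 v c by exact: is_derive_affine.
have vt0 : v t0 = 1 by rewrite /v /c /d; field.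
have dk x : I x -> is_derive x 1 (fun x => g x * v x - g t0)
    (g x / 2 * (g x * v x - g t0)).
  move=> Ix.
  have h := is_deriveD (is_deriveM (dg x Ix) (dv x)) (is_derive_cst (- g t0) x 1).
  by apply: (is_derive_eq h); rewrite /GRing.scale /= /c; field.
have k0 x : I x -> g x * v x = g t0.
  (* By [dk], the square of [g v - g t0] solves [y' = g y], and so does [f1]. Their quotient is
     therefore constant, and it vanishes at [t0]. Here [f1] serves as the integrating factor. *)
  move=> Ix; pose K (x : R) : R := (g x * v x - g t0) ^+ 2 / f1 x.
  have dK y : I y -> is_derive y 1 K 0.
    move=> Iy; have h := is_derive_div
      (t := y) (f := fun x => (g x * v x - g t0) ^+ 2) (g := f1) (f0 y Iy)
      (is_deriveX 2 (dk y Iy)) (d1 y Iy).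
    apply: (is_derive_eq h); rewrite fg// /GRing.scale /= expr1.
    by field; exact: f0.
  have := derive0_const iI dK Ix It0.
  rewrite {2}/K vt0 mulr1 subrr expr0n /= mul0r /K => /eqP.
  rewrite mulf_eq0 invr_eq0 (negbTE (f0 x Ix)) orbF expf_eq0 /= subr_eq0.
  by move/eqP.
have w x : I x -> f1 x * v x ^+ 2 = f1 t0.
  move=> Ix; pose W (x : R) : R := f1 x * v x ^+ 2.
  have dW y : I y -> is_derive y 1 W 0.
    move=> Iy; have h := is_deriveM (d1 y Iy) (is_deriveX 2 (dv y)).
    apply: (is_derive_eq h); rewrite exprfctE fg// /GRing.scale /= expr1 /c -(k0 y Iy).
    by field.
  by have := derive0_const iI dW Ix It0; rewrite /W vt0 expr1n mulr1.
(* A zero of [v] in [I] would make the nonzero constant [f1 t0 = f1 x * v x ^+ 2] vanish, so the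
   pole stays outside [I]. *)
have v0 x : I x -> v x != 0.
  move=> Ix; apply: contraTneq (f0 t0 It0) => vx.
  by rewrite -(w x Ix) vx expr0n /= mulr0 negbK.
have E x : I x -> f x - f1 t0 * (x - t0) / v x = f t0.
  move=> Ix; pose F (x : R) : R := f x - f1 t0 * (x - t0) / v x.
  have dF y : I y -> is_derive y 1 F 0.
    move=> Iy; have dl : is_derive y 1 (fun x => f1 t0 * (x - t0)) (f1 t0).
      have h := is_deriveZ (f1 t0) (is_deriveD (is_derive_id y 1)
        (is_derive_cst (- t0) y 1)).
      by apply: (is_derive_eq h); rewrite addr0 /GRing.scale /= mulr1.
    have h := is_deriveB (d0 y Iy) (is_derive_div (t := y) (g := v) (v0 y Iy) dl (dv y)).
    apply: (is_derive_eq h); have := v0 y Iy; rewrite -(w y Iy) => vy.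
    have e : v y = c * (y - t0) + 1 by rewrite -vt0 /v; ring.
    (* The factor [v y - c * (y - t0)] equals 1 by [e]. Once it is inserted, the goal is a rational
       identity with [v y] as an independent quantity. *)
    rewrite /= [X in X - _](_ : f1 y = f1 y * v y ^+ 2 * (v y - c * (y - t0)) / v y ^+ 2).
      by field; exact: vy.
    by rewrite {2}e addrAC subrr add0r mulr1 mulfK// expf_neq0.
  have := derive0_const iI dF Ix It0.
  by rewrite {2}/F subrr mulr0 mul0r subr0.
(* The numerator is [f t0 * v x + f1 t0 * (x - t0)], from [E] put over the denominator [v x]. The
   determinant comes out as [f1 t0 * v t0]. *)
exists (f t0 * c + f1 t0), (f t0 * d - f1 t0 * t0), c, d; split.
- rewrite (_ : _ - _ = f1 t0 * v t0); last by rewrite /v; ring.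
  by rewrite vt0 mulr1 f0.
- exact: v0.
- move=> x Ix; have vx := v0 x Ix; rewrite /moebius -/(v x).
  rewrite -[LHS](subrK (f1 t0 * (x - t0) / v x)) E//.
  have -> : (f t0 * c + f1 t0) * x + (f t0 * d - f1 t0 * t0) =
    f t0 * v x + f1 t0 * (x - t0) by rewrite /v; ring.
  by rewrite mulrDl mulfK.
Qed.

Lemma diffeo_eq_on I J f g : open I -> (forall t, I t -> f t = g t) ->
  diffeo I J f -> diffeo I J g.
Proof.
move=> oI fg [sf bf [h sh hK]]; split.
- apply/smooth_ckP => k; apply: (eq_on_ck oI fg).
  by move/smooth_ckP: sf; exact.
- by apply: eq_set_bijRL bf => t /set_mem; exact: fg.
- by exists h => // t It; rewrite -fg ?hK.
Qed.

Lemma log_derive1_eq_on I f g : open I -> (forall t, I t -> f t = g t) ->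
  forall t, I t -> log_derive1 f t = log_derive1 g t.
Proof.
move=> oI fg t It; rewrite /log_derive1 (eq_on_derive1n oI fg)//.
by rewrite (eq_on_derive1 oI fg).
Qed.

End Moebius.

(** * Comparison of two frames: transition matrices and uniqueness up to a linear map *)

Section Congruence.
Variables (R : realType) (n : nat).
Implicit Types (A B F : R -> 'M[R]_(n + n, n)) (I J : set R).

Lemma juxt_mull A (T : 'M[R]_(n + n)) (X : 'M[R]_n) t :
  T *m A t *m X = T *m juxt A t *m col_mx X 0.
Proof. by rewrite -!mulmxA mul_row_col mulmx0 addr0. Qed.

(** Equality of spans gives [X t] pointwise, and the two inclusions make it invertible. Smoothness
    follows from the closed formula: [X] is the upper block of the coordinates of [F] in the basis
    [T *m juxt A]. *)
Lemma frame_transition I A F (T : 'M[R]_(n + n)) :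
  fanning_frame I A -> fanning_frame I F -> T \in unitmx ->
  (forall t, I t -> colspan (F t) = (linfun (mulmx T) @: colspan (A t))%VS) ->
  exists2 X : R -> 'M[R]_n, smooth_on I X &
    forall t, I t -> X t \in unitmx /\ F t = T *m A t *m X t.
Proof.
move=> [[oI _ _] sA uA] [_ sF uF] uT FA.
have uTA t : I t -> T *m juxt A t \in unitmx.
  by move=> It; rewrite unitmx_mul uT uA.
exists (fun t => usubmx (invmx (T *m juxt A t) *m F t)).
  apply/smooth_ckP => k; apply: ck_usubmx => //.
  apply: (ck_mulmx oI); last by move/smooth_ckP: sF; exact.
  apply: (ck_invmx oI uTA); apply: (ck_mulmx oI); first exact: ck_cst.
  exact: ck_juxt.
move=> t It; have := FA t It; rewrite colspan_mulmxl => e.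
have /colspan_subP[Y FY] : (colspan (F t) <= colspan (T *m A t))%VS.
  by rewrite e subvv.
have /colspan_subP[Z AZ] : (colspan (T *m A t) <= colspan (F t))%VS.
  by rewrite e subvv.
have -> : usubmx (invmx (T *m juxt A t) *m F t) = Y.
  by rewrite FY juxt_mull mulKmx ?uTA// col_mxKu.
split=> //.
have YZ : Y *m Z = 1%:M.
  have : T *m juxt A t *m col_mx (Y *m Z) 0 = T *m juxt A t *m col_mx 1%:M 0.
    by rewrite -!juxt_mull mulmx1 mulmxA -FY.
  by move/(can_inj (mulKmx (uTA t It)))/eq_col_mx => [].
by have [] := mulmx1_unit YZ.
Qed.

(** Insert [F = T A X] into [F'' - g F' + F Q = 0] and compare coefficients. That of [A'] gives
    [X' = (g / 2) X]; differentiating this once more eliminates [X''] from the coefficient of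
    [A]. *)
Lemma transition_equations I A F (T : 'M[R]_(n + n)) (X : R -> 'M[R]_n)
    (g : R -> R) :
  normal_frame I A -> fanning_frame I F -> T \in unitmx ->
  smooth_on I X -> (forall t, I t -> F t = T *m A t *m X t) ->
  (forall t, I t -> frameP F t = - (g t)%:M) ->
  (forall t, I t -> is_derive t 1 g (g^`() t)%classic) ->
  forall t, I t -> is_derive t 1 X ((g t / 2) *: X t) /\
  (g^`()%classic t - g t ^+ 2 / 2) *: X t = 2 *: (frameQ A t *m X t - X t *m frameQ F t).
Proof.
move=> nA fF uT sX FE Pg dg.
have [fA _] := nA; have [[oI _ _] sA uA] := fA.
pose X1 := (X^`())%classic; pose X2 := (X^`(2))%classic.
have d1 t : I t -> is_derive t 1 X (X1 t) := smooth_is_derive 0 sX.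
have d2 t : I t -> is_derive t 1 X1 (X2 t) := smooth_is_derive 1 sX.
pose A1 := (A^`())%classic; pose A2 := (A^`(2))%classic.
have dA1 t : I t -> is_derive t 1 A (A1 t) := smooth_is_derive 0 sA.
have dA2 t : I t -> is_derive t 1 A1 (A2 t) := smooth_is_derive 1 sA.
have dTA t : I t -> is_derive t 1 (fun t => T *m A t) (T *m A1 t).
  move=> It; have := is_derive_mulmx (is_derive_cst T t 1) (dA1 t It).
  by rewrite mul0mx addr0.
have dTA1 t : I t -> is_derive t 1 (fun t => T *m A1 t) (T *m A2 t).
  move=> It; have := is_derive_mulmx (is_derive_cst T t 1) (dA2 t It).
  by rewrite mul0mx addr0.
have F1 t : I t -> (F^`() t)%classic = T *m A t *m X1 t + T *m A1 t *m X t.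
  move=> It; rewrite (eq_on_derive1 oI FE It).
  exact: (derive1_is_derive (is_derive_mulmx (dTA t It) (d1 t It))).
have F2 t : I t -> (F^`(2) t)%classic =
    (T *m A t *m X2 t + T *m A1 t *m X1 t) + (T *m A1 t *m X1 t + T *m A2 t *m X t).
  move=> It; rewrite derive1nS (eq_on_derive1 oI F1 It).
  exact: (derive1_is_derive (is_deriveD (is_derive_mulmx (dTA t It) (d2 t It))
    (is_derive_mulmx (dTA1 t It) (d1 t It)))).
have key t : I t -> 2 *: X1 t - g t *: X t = 0 /\
    X2 t - g t *: X1 t + X t *m frameQ F t - frameQ A t *m X t = 0.
  move=> It; apply: (juxt_eq0 (uA t It)).
  have := frame_eq fF It; rewrite Pg//.
  rewrite F1// F2// FE// mulmxN mul_mx_scalar.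
  have [_ _] := normal_frame_eqs nA It; rewrite -/A2 => ->.
  rewrite [X in X = 0 -> _](_ : _ = T *m (A1 t *m (2 *: X1 t - g t *: X t) +
      A t *m (X2 t - g t *: X1 t + X t *m frameQ F t - frameQ A t *m X t))).
    by move/(congr1 (mulmx (invmx T))); rewrite mulKmx// mulmx0.
  move: (frameQ A t) (frameQ F t) => QA QF.
  rewrite !(mulmxDr, mulmxN, mulNmx) -!scalemxAr !mulmxA.
  by apply/matrixP => i j; rewrite !mxE; ring.
have X1E t : I t -> X1 t = (g t / 2) *: X t.
  move=> It; have [/eqP + _] := key t It.
  rewrite subr_eq0 => /eqP e.
  by rewrite mulrC -scalerA -e scalerA mulVf ?scale1r// pnatr_eq0.
move=> t It; split; first by rewrite -X1E//; exact: d1.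
have dg2 : is_derive t 1 (fun t => g t / 2) (g^`()%classic t / 2).
  have h := is_deriveM (dg t It) (is_derive_cst (2^-1 : R) t 1).
  by apply: (is_derive_eq h); rewrite /GRing.scale /= mulr0 add0r mulrC.
have X2E : X2 t = (g t / 2) *: X1 t + (g^`()%classic t / 2) *: X t.
  have := d2 t It; move/derive1_is_derive <-.
  rewrite (eq_on_derive1 oI X1E It).
  exact: (derive1_is_derive (is_derive_scalemx dg2 (d1 t It))).
have [_] := key t It; rewrite X2E X1E//.
move: (frameQ A t) (frameQ F t) => QA QF /matrixP e.
apply/matrixP => i j; have := e i j; rewrite !mxE => {}e.
apply/eqP; rewrite -subr_eq0; apply/eqP.
by apply: etrans (etrans (congr1 (fun z => 2 * z) e) (mulr0 2)); field.
Qed.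

(* Both juxtapositions solve J' = J C with the same C, so that
   juxt F *m invmx (juxt A) is constant. *)
Lemma frame_unique I A F : fanning_frame I A -> smooth_on I F ->
  (forall t, I t -> juxt F t \in unitmx) ->
  (forall t, I t -> (A^`(2) t)%classic = - (A t *m frameQ A t)) ->
  (forall t, I t -> (F^`(2) t)%classic = - (F t *m frameQ A t)) ->
  exists2 T : 'M[R]_(n + n), T \in unitmx & forall t, I t -> F t = T *m A t.
Proof.
move=> [[oI iI [t0 It0]] sA uA] sF uF A2 F2.
(* The companion matrix of the equation [G'' = - G Q]. *)
pose C t : 'M[R]_(n + n) := block_mx 0 (- frameQ A t) 1%:M 0.
have dJ G t : smooth_on I G -> I t ->
    (G^`(2) t)%classic = - (G t *m frameQ A t) ->
    is_derive t 1 (juxt G) (juxt G t *m C t).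
  move=> sG It G2.
  have := is_derive_row_mx (smooth_is_derive 0 sG It) (smooth_is_derive 1 sG It).
  by rewrite G2 /juxt /C mul_row_block !mulmx0 mulmx1 add0r addr0 mulmxN.
pose T t := juxt F t *m invmx (juxt A t).
have dT t : I t -> is_derive t 1 T 0.
  move=> It.
  have dA := dJ A t sA It (A2 t It); have dF := dJ F t sF It (F2 t It).
  have ci := ck_invmx oI uA (ck_juxt (k := 1) oI sA).
  have di := ck_on_is_derive ci It.
  (* [D] is the derivative of [invmx (juxt A)], so far only known to exist. Differentiating
     [juxt A *m invmx (juxt A) = 1] determines it. *)
  set D := (X in is_derive _ _ _ X) in di.
  have d1 : is_derive t 1 (fun=> 1%:M : 'M[R]_(n + n)) 0 := is_derive_cst _ t 1.
  have d1' : is_derive t 1 (fun x => juxt A x *m invmx (juxt A x)) 0.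
    by apply: (eq_on_is_derive oI _ It d1) => x Ix; rewrite mulmxV// uA.
  have := is_derive_unique (is_derive_mulmx dA di) d1'.
  move/eqP; rewrite addr_eq0 => /eqP e.
  apply: (is_derive_eq (is_derive_mulmx dF di)).
  by rewrite -[D](mulKmx (uA t It)) e !mulmxN -!mulmxA mulKmx ?uA// addNr.
exists (T t0); first by rewrite unitmx_mul uF// unitmx_inv uA.
move=> t It; have := derive0_constmx iI dT It0 It => ->.
have : T t *m juxt A t = juxt F t by rewrite /T mulmxKV// uA.
by rewrite /juxt mul_mx_row => /eq_row_mx [].
Qed.

End Congruence.

(** * Change of representatives, and the two directions of the equivalence *)

Section Main.
Variables (R : realType) (n : nat).
Implicit Types (A B F : R -> 'M[R]_(n + n, n)) (I J : set R).

Lemma fanning_curve_open (l : pcurve R n) : fanning_curve l -> open (pdom l).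
Proof. by move=> [A [[oI _ _] _ _] _]. Qed.

Lemma reparam_sym (l m : pcurve R n) : reparam l m -> reparam m l.
Proof.
move=> [s ds lm]; have [g dg gK] := diffeo_sym ds.
exists g => // x Jx; have [_ [_ _ fs] _] := ds.
by have [t It <-] := fs x Jx; rewrite gK// lm.
Qed.

Lemma reparam_trans (l m p : pcurve R n) :
  open (pdom l) -> open (pdom m) -> open (pdom p) ->
  reparam l m -> reparam m p -> reparam l p.
Proof.
move=> ol om op [s ds lm] [r dr mp]; exists (r \o s).
  exact: diffeo_comp ds dr.
have [_ [sI _ _] _] := ds.
by move=> t It; rewrite /= mp ?lm//; exact: sI.
Qed.

(** Both members are reparameterizations of one base curve [c], through which the change of
    parameter is composed. *)
Lemma unparam_reparam (C : set (pcurve R n)) (l m : pcurve R n) :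
  unparam_fanning_curve C -> C l -> C m ->
  [/\ open (pdom l), open (pdom m) & reparam l m].
Proof.
move=> [c /fanning_curve_open oc ->] [/fanning_curve_open ol cl].
move=> [/fanning_curve_open om cm]; split=> //.
exact: (reparam_trans ol oc om (reparam_sym cl) cm).
Qed.

Lemma scaled_conj (a : R) (X Q : 'M[R]_n) : a != 0 -> X \in unitmx ->
  invmx (a *: X) *m Q *m (a *: X) = invmx X *m Q *m X.
Proof.
move=> a0 uX; have aX : a *: X \in unitmx by rewrite unitmxZ// unitfE.
rewrite invmxZ// -scalemxAr -!scalemxAl scalerA divff// scale1r.
by [].
Qed.

(** [B \o f] and [T A] span the same curve, so the transition equations apply. Their trace
    determines the type of [f], and what remains of them is the conjugation. *)
Lemma congruent_frames_conjugate I J A B (T : 'M[R]_(n + n)) (f : R -> R) :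
  (0 < n)%N -> special_normal_frame I A -> special_normal_frame J B ->
  T \in unitmx -> diffeo I J f ->
  (forall t, I t ->
    colspan (B (f t)) = (linfun (mulmx T) @: colspan (A t))%VS) ->
  exists (s : R -> R) (X : 'M[R]_n),
    [/\ projective_change I J s, X \in unitmx &
        forall t, I t ->
          schwarzian (B \o s) t = invmx X *m schwarzian A t *m X].
Proof.
move=> n0 [nA trA] [nB trB] uT df BA.
have [fA _] := nA; have [iI _ _] := fA; have [oI itI [t0 It0]] := iI.
have [_ [IJ _ _] _] := df.
have [fF Fcomp] := normal_frame_comp iI df nB.
have [X sX XE] := frame_transition fA fF uT BA.
have uX t : I t -> X t \in unitmx by move=> /XE [].
have FE t : I t -> (B \o f) t = T *m A t *m X t by move=> /XE [].
set g := log_derive1 f in Fcomp.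
have dg t : I t -> is_derive t 1 g (g^`() t)%classic :=
  derivable_log_derive1 oI df.
have Pg t : I t -> frameP (B \o f) t = - (g t)%:M by move=> /Fcomp [].
have eqs := transition_equations nA fF uT sX FE Pg dg.
have trQA t : I t -> \tr (frameQ A t) = 0.
  move=> It; have [_ e _] := normal_frame_eqs nA It.
  by have := trA t It; rewrite e mxtraceZ => /eqP; rewrite mulf_eq0 pnatr_eq0 => /eqP.
have trQB t : J t -> \tr (frameQ B t) = 0.
  move=> It; have [_ e _] := normal_frame_eqs nB It.
  by have := trB t It; rewrite e mxtraceZ => /eqP; rewrite mulf_eq0 pnatr_eq0 => /eqP.
have trQF t : I t -> \tr (frameQ (B \o f) t) = 0.
  move=> It; have [_ -> _] := Fcomp t It.
  by rewrite mxtraceZ (trQB _ (IJ t It)) mulr0.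
(* After multiplication by the inverse of [X t], the right-hand side has trace zero by cyclicity,
   while the left-hand side has trace [n] times the Riccati defect; [n] is nonzero. *)
have ric t : I t -> (g^`() t)%classic = g t ^+ 2 / 2.
  move=> It; have [_ e] := eqs t It.
  move: (frameQ A t) (frameQ (B \o f) t) (trQA t It) (trQF t It) e.
  move=> QA QF TA TF e; have := congr1 (fun Y => \tr (invmx (X t) *m Y)) e.
  rewrite -scalemxAr mulVmx ?uX// -scalemxAr mulmxBr mulKmx ?uX//.
  rewrite !mxtraceZ raddfB /= mulmxA mxtrace_mulC mulmxA mulmxV ?uX//.
  rewrite mul1mx TA TF.
  rewrite subrr mulr0 mxtrace1 => /eqP.
  by rewrite mulf_eq0 pnatr_eq0 (gtn_eqF n0) orbF subr_eq0 => /eqP.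
have [a [b [c [d [det0 v0 fE]]]]] := riccati_moebius iI df ric.
have gE t : I t -> g t = - 2 * c / (c * t + d).
  move=> It; rewrite /g (log_derive1_eq_on oI fE It).
  exact: (moebius_log_derive1 oI det0 v0).
have conj t : I t ->
    schwarzian (B \o f) t = invmx (X t) *m schwarzian A t *m X t.
  move=> It; have [_ _ ->] := Fcomp t It; have [_ -> _] := normal_frame_eqs nA It.
  have [_] := eqs t It; have uXt := uX t It.
  rewrite (ric t It) subrr raddf0 addr0 scale0r.
  move: (frameQ A t) (frameQ (B \o f) t) => QA QF /esym/eqP.
  rewrite scaler_eq0 pnatr_eq0 /= subr_eq0 => /eqP e.
  by rewrite -scalemxAr -scalemxAl -mulmxA e mulKmx.
pose Y t := (c * t + d) *: X t.
have dY t : I t -> is_derive t 1 Y 0.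
  move=> It; have [dX _] := eqs t It.
  apply: (is_derive_eq (is_derive_scalemx (is_derive_affine c d t) dX)).
  rewrite scalerA -scalerDl gE// (_ : _ + _ = 0) ?scale0r//.
  by field; exact: v0.
(* [projective_change] asks for a projective formula on the whole line, and [f] is known to have one
   only on [I]; hence [moebius a b c d] replaces [f]. The factor [c t + d] that makes [Y] constant
   cancels in the conjugation. *)
exists (moebius a b c d), (Y t0); split.
- exists a, b, c, d; split; first by [].
  exact: (diffeo_eq_on oI fE df).
- by rewrite /Y unitmxZ ?uX// unitfE v0.
move=> t It; rewrite (derive0_constmx itI dY It0 It).
rewrite (scaled_conj _ (v0 t It) (uX t It)) -(conj t It).
by apply: (schwarzian_eq_on oI _ It) => x Ix /=; rewrite fE.
Qed.

(** The weight [v = c t + d] removes the first order term from the equation of [F = B \o s], and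
    right multiplication by the inverse of [X] turns its zeroth order coefficient into that of [A].
    The weighted frame [H] and [A] then solve the same equation. *)
Lemma conjugate_frames_congruent I J A B (X : 'M[R]_n) (s : R -> R) :
  normal_frame I A -> normal_frame J B -> projective_change I J s ->
  X \in unitmx ->
  (forall t, I t ->
    schwarzian (B \o s) t = invmx X *m schwarzian A t *m X) ->
  exists2 T : 'M[R]_(n + n), T \in unitmx & forall t, I t ->
    colspan (B (s t)) = (linfun (mulmx T) @: colspan (A t))%VS.
Proof.
move=> nA nB [a [b [c [d [[sE det0 v0] ds]]]]] uX conj.
have [fA _] := nA; have [iI _ _] := fA; have [oI itI _] := iI.
have [fF Fcomp] := normal_frame_comp iI ds nB.
have gE t : I t -> log_derive1 s t = - 2 * c / (c * t + d).
  by move=> It; rewrite sE; exact: (moebius_log_derive1 oI det0 v0).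
have ric t : I t -> ((log_derive1 s)^`() t)%classic = log_derive1 s t ^+ 2 / 2.
  by move=> It; rewrite sE; exact: (moebius_riccati oI det0 v0).
set F := B \o s in fF Fcomp conj.
have QF t : I t -> frameQ F t *m invmx X = invmx X *m frameQ A t.
  move=> It; have := conj t It; have [_ _ ->] := Fcomp t It.
  have [_ -> _] := normal_frame_eqs nA It.
  rewrite (ric t It) subrr raddf0 addr0.
  move: (frameQ A t) (frameQ F t) => QA QF.
  rewrite -scalemxAr -scalemxAl => /(scalerI _) ->; last by rewrite pnatr_eq0.
  by rewrite mulmxK.
have [_ sF uF] := fF.
pose v t := c * t + d.
pose F1 := (F^`())%classic; pose F2 := (F^`(2))%classic.
have dF1 t : I t -> is_derive t 1 F (F1 t) := smooth_is_derive 0 sF.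
have dF2 t : I t -> is_derive t 1 F1 (F2 t) := smooth_is_derive 1 sF.
pose H t := v t *: F t *m invmx X.
have dv (t : R) : is_derive t 1 v c := is_derive_affine c d t.
have dc (t : R) : is_derive t 1 (fun=> c) 0 := is_derive_cst c t 1.
have dX (t : R) : is_derive t 1 (fun=> invmx X) 0 := is_derive_cst _ t 1.
have dH1 t : I t -> is_derive t 1 H ((v t *: F1 t + c *: F t) *m invmx X).
  move=> It; have := is_derive_mulmx (is_derive_scalemx (dv t) (dF1 t It)) (dX t).
  by rewrite mulmx0 add0r.
have H1 t : I t -> (H^`() t)%classic = (v t *: F1 t + c *: F t) *m invmx X.
  by move=> It; exact: (derive1_is_derive (dH1 t It)).
have H2 t : I t -> (H^`(2) t)%classic = - (H t *m frameQ A t).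
  move=> It; rewrite derive1nS (eq_on_derive1 oI H1 It).
  have h := is_derive_mulmx (is_deriveD (is_derive_scalemx (dv t) (dF2 t It))
    (is_derive_scalemx (dc t) (dF1 t It))) (dX t).
  rewrite (derive1_is_derive h) mulmx0 add0r scale0r addr0.
  (* Because of this, [v] times the equation of [F] reads [v F'' + 2 c F' = - v F Q], whose
     left-hand side is the second derivative of [v F]. *)
  have vg : v t * log_derive1 s t = - 2 * c by rewrite gE// mulrC divfK// v0.
  have := frame_eq fF It; have [-> _ _] := Fcomp t It.
  rewrite -/F2 -/F1 mulmxN mul_mx_scalar => e.
  rewrite /H -mulmxA -(QF t It) mulmxA -mulNmx; congr (_ *m _).
  rewrite -scalemxAl; move: (F t *m frameQ F t) e => M e.
  apply/matrixP => i j; have /matrixP/(_ i j) := e; rewrite !mxE => {}e.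
  apply/eqP; rewrite -subr_eq0; apply/eqP.
  apply: etrans (etrans (congr1 (fun z => v t * z) e) (mulr0 _)).
  by rewrite !mulrDr mulrN mulrA vg; ring.
have sH : smooth_on I H.
  apply/smooth_ckP => k; apply: (ck_mulmx oI); last exact: ck_cst.
  apply: (ck_scale oI); last by move/smooth_ckP: sF; exact.
  apply: (ckD oI); last exact: ck_cst.
  by apply: (ckM oI); [exact: ck_cst|exact: ck_id].
have uH t : I t -> juxt H t \in unitmx.
  (* The change of basis is block triangular with invertible diagonal blocks. *)
  move=> It; have -> : juxt H t = juxt F t *m
    block_mx (v t *: invmx X) (c *: invmx X) 0 (v t *: invmx X).
    rewrite /juxt mul_row_block mulmx0 addr0 H1// /H.
    by rewrite -!scalemxAr mulmxDl -!scalemxAl addrC.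
  rewrite unitmx_mul uF// andTb unitmxE det_ublock.
  by rewrite unitrM andbb -unitmxE unitmxZ ?unitmx_inv// unitfE v0.
have [_ sA uA] := fA.
have A2 t : I t -> (A^`(2) t)%classic = - (A t *m frameQ A t).
  by move=> It; have [] := normal_frame_eqs nA It.
have [T uT HT] := frame_unique fA sH uH A2 H2.
exists T => // t It; rewrite colspan_mulmxl -HT//.
rewrite /H -scalemxAl scalemxAr colspan_mulmxr//.
by rewrite unitmxZ ?unitmx_inv// unitfE v0.
Qed.

End Main.

Theorem theorem1p8 (R : realType) (n : nat) (n_gt0 : (0 < n)%N)
    (C D : set (pcurve R n))
    (hC : unparam_fanning_curve C) (hD : unparam_fanning_curve D)
    (I J : set R) (A B : R -> 'M[R]_(n + n, n))
    (hA : special_normal_frame I A) (hB : special_normal_frame J B)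
    (hAC : C (Pcurve I (fun t => colspan (A t))))
    (hBD : D (Pcurve J (fun s => colspan (B s)))) :
  congruent C D <->
  exists (s : R -> R) (X : 'M[R]_n),
    [/\ projective_change I J s, X \in unitmx &
        forall t, I t ->
          schwarzian (B \o s) t = invmx X *m schwarzian A t *m X].
Proof.
split=> [[l [m [Cl Dm [T [s [uT ds lm]]]]]]|[s [X [ps uX conj]]]].
  (* Congruence comes with its own representatives [l] and [m]. The diffeomorphisms from [I] to
     [pdom l], from there to [pdom m], and on to [J] are composed to relate [A] and [B] directly. *)
  have [oI ol [p dp Al]] := unparam_reparam hC hAC Cl.
  have [om oJ [q dq mB]] := unparam_reparam hD Dm hBD.
  have [_ [pI _ _] _] := dp; have [_ [sl _ _] _] := ds.
  have dsp := diffeo_comp oI ol om dp ds.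
  apply: (congruent_frames_conjugate n_gt0 hA hB uT
    (diffeo_comp oI om oJ dsp dq)) => t It.
  have plt : pdom l (p t) by exact: pI.
  have mE := mB _ (sl _ plt); have lE := Al t It; rewrite /= in mE lE.
  by rewrite -lE -(lm _ plt) -mE.
have [T uT TE] := conjugate_frames_congruent hA.1 hB.1 ps uX conj.
exists (Pcurve I (fun t => colspan (A t))), (Pcurve J (fun s => colspan (B s))).
by split=> //; exists T, s; split=> //; case: ps => [? [? [? [? []]]]].
Qed.
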